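(* Let $0<q<1$, $\alpha>0$, let $a$ be a real number, and let $$f(x)={}_{m-k}\Phi_{m-1}\left[\left.\begin{array}{c}a_1,a_2,\dots,a_{m-k}\\ b_1,b_2,\dots,b_{m-1}\end{array}\right|q,ax\right].$$ Then $${}_qN\left(x^{\alpha-1}f(x)\right)(u;v)=\frac{\left(\frac uv\right)^{\alpha}(1-q)^{\alpha-1}\Gamma_q(\alpha)}{K\left(\frac uv;\alpha\right)}\;{}_{m-k+1}\Phi_{m-1}\left[\left.\begin{array}{c}a_1,a_2,\dots,a_{m-k},q^{\alpha}\\ b_1,b_2,\dots,b_{m-1}\end{array}\right|q,\frac{au}{vq^{\alpha}}\right].$$
   Context: For $0<q<1$: $(a;q)_n=\prod_{k=0}^{n-1}(1-aq^k)$, $(a;q)_\infty=\lim_{n\to\infty}(a;q)_n$, $(a_1,\dots,a_p;q)_n=\prod_{j=1}^p(a_j;q)_n$. The $q$-gamma function is $\Gamma_q(x)=\frac{(q;q)_\infty}{(q^x;q)_\infty}(1-q)^{1-x}$. For real $t$, $$K(A;t)=A^{t-1}\frac{(-q/A;q)_\infty}{(-q^t/A;q)_\infty}\,\frac{(-A;q)_\infty}{(-Aq^{1-t};q)_\infty}.$$ The $q$-hypergeometric function is $${}_{m-k}\Phi_{m-1}\left[\left.\begin{array}{c}a_1,\dots,a_{m-k}\\ b_1,\dots,b_{m-1}\end{array}\right|q,z\right]=\sum_{n\ge0}\frac{(a_1,\dots,a_{m-k};q)_n}{(b_1,\dots,b_{m-1};q)_n}\left[(-1)^nq^{\binom n2}\right]^{k}\frac{z^n}{(q;q)_n},$$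 so that ${}_{m-k+1}\Phi_{m-1}$ carries the exponent $k-1$ in place of $k$. With $e_q(t)=\frac1{(t;q)_\infty}$ for $t<1$ and $\int_0^\infty f(x)\,d_qx=(1-q)\sum_{j\in\mathbb{Z}}q^jf(q^j)$, the $q$-Natural transform of the second type, with transform variables $u$ and $v$, is defined, when the integral exists, by $${}_qN(f)(u;v)=\frac1{1-q}\int_0^\infty f(t)\,e_q\!\left(-\tfrac vu t\right)d_qt,$$ over the set of functions $f$ for which there are $M$, $\tau_1$ and/or $\tau_2>0$ with $|f(t)|<M e_q(|t|/\tau_j)$ for $t\in(-1)^j\times[0,\infty)$, $j=1,2$. Here ${}_qN(g(x))(u;v)$ denotes the transform of the function $x\mapsto g(x)$.
   Formalization: The argument of the right-hand series is -au/(vq^α): the printed plus sign is false. Made explicit so that both sides are defined: u/v>0, no (b_j;q)_n vanishes, the series f(x) converges for all x>0, and the right-hand series converges. *)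

(* Defs.v *)
(* Stdlib reals with Coquelicot (series, complex numbers). *)
From Stdlib Require Import Reals List ZArith.
From Coquelicot Require Import Coquelicot.
Open Scope R_scope.

Fixpoint qpoch (q a : R) (n : nat) : R :=
  match n with
  | O => 1
  | S n' => qpoch q a n' * (1 - a * q ^ n')
  end.

(* For 0 < q < 1 the limit exists and is finite for every a. *)
Definition qpoch_inf (q a : R) : R := real (Lim_seq (qpoch q a)).

(* The parameters of hypergeometric functions may be complex. *)
Fixpoint Cqpoch (q : R) (a : C) (n : nat) : C :=
  match n with
  | O => RtoC 1
  | S n' => (Cqpoch q a n' * (1 - a * RtoC (q ^ n')))%C
  end.

Definition Cqpochs (q : R) (l : list C) (n : nat) : C :=
  fold_right (fun a r => (Cqpoch q a n * r)%C) (RtoC 1) l.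

Definition e_q (q t : R) : R := / qpoch_inf q t.

Definition Gamma_q (q x : R) : R :=
  qpoch_inf q q / qpoch_inf q (Rpower q x) * Rpower (1 - q) (1 - x).

Definition K_q (q A t : R) : R :=
  Rpower A (t - 1)
  * (qpoch_inf q (- q / A) / qpoch_inf q (- Rpower q t / A))
  * (qpoch_inf q (- A) / qpoch_inf q (- A * Rpower q (1 - t))).

(* General term of r_Phi_s with r = length la, s = length lb.  The power of
   (-1)^n q^(n choose 2) is the integer 1 + s - r: it is k for r = m - k and
   k - 1 for r = m - k + 1, when s = m - 1. *)
Definition qhyp_term (q : R) (la lb : list C) (z : C) (n : nat) : C :=
  (Cqpochs q la n / Cqpochs q lb n
   * RtoC (powerRZ ((-1) ^ n * q ^ (n * (n - 1) / 2)%nat)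
             (1 + Z.of_nat (length lb) - Z.of_nat (length la)))
   * (z ^ n / RtoC (qpoch q q n)))%C.

Definition ex_qhyp (q : R) (la lb : list C) (z : C) : Prop :=
  @ex_series C_AbsRing C_NormedModule (qhyp_term q la lb z).

(* Sum of the series, by real and imaginary parts; meaningful under ex_qhyp. *)
Definition qhyp (q : R) (la lb : list C) (z : C) : C :=
  (Series (fun n => Re (qhyp_term q la lb z n)),
   Series (fun n => Im (qhyp_term q la lb z n))).

Definition is_bilateral_series (F : Z -> C) (l : C) : Prop :=
  exists lp ln : C,
    @is_series C_AbsRing C_NormedModule (fun n => F (Z.of_nat n)) lp /\
    @is_series C_AbsRing C_NormedModule (fun n => F (- Z.of_nat (S n))%Z) ln /\
    l = (lp + ln)%C.

Definition is_qint (q : R) (f : R -> C) (I : C) : Prop :=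
  exists l : C,
    is_bilateral_series
      (fun j => (RtoC (powerRZ q j) * f (powerRZ q j))%C) l /\
    I = (RtoC (1 - q) * l)%C.

(* "The transform of f at (u; v) exists and equals N".  The transform is
   used for u / v > 0, where - (v / u) * t < 1 for all t >= 0. *)
Definition is_qNatural (q : R) (f : R -> C) (u v : R) (N : C) : Prop :=
  exists I : C,
    is_qint q (fun t => (f t * RtoC (e_q q (- (v / u) * t)))%C) I /\
    N = (RtoC (/ (1 - q)) * I)%C.

(* Main.v *)
(* With x = v/u and z = q^alpha, expanding f and exchanging sums turns the transform
   into sum_n c_n S(z q^n), where S(z) = sum_{j in Z} z^j / (-x q^j; q)_oo.
   Since S(zq) = S(z) (1 - z) / (xz), S(z q^n) is S(z) (z; q)_n / (z^n x^n q^(n choose 2)),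
   which produces the series with the extra parameter q^alpha.
   To evaluate S(z), iterate that functional equation to infinity:
   S(z) (z; q)_oo theta(x) = sum_j z^j theta(x) / theta(x q^j), with
   theta(x) = (-x; q)_oo (-q/x; q)_oo.  As theta(xq) = theta(x) / x, the right-hand side
   depends only on xz, so S(z) is determined by S(q), which telescopes to 1/x.
   The exchange needs absolute convergence of the resulting series; for basic
   hypergeometric series convergence implies absolute convergence. *)
Require Import Defs.
From Stdlib Require Import Reals List ZArith Lra Lia Classical.
From Coquelicot Require Import Coquelicot.
Open Scope R_scope.

(** * Complex series through real and imaginary parts *)

Lemma sum_n_C (a : nat -> C) (n : nat) :
  @sum_n C_NormedModule a n
  = (sum_n (fun n => Re (a n)) n, sum_n (fun n => Im (a n)) n) :> C.
Proof.
induction n as [|n IH].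
- rewrite !sum_O; now destruct (a 0%nat).
- rewrite !sum_Sn, IH; reflexivity.
Qed.

(** Balls of [C_UniformSpace] are products of balls in the two coordinates, so partial sums converge
    coordinatewise. This links complex convergence to [qhyp], which sums the coordinates
    separately. *)
Lemma is_series_C (a : nat -> C) (l : C) :
  @is_series C_AbsRing C_NormedModule a l <->
  is_series (fun n => Re (a n)) (Re l) /\ is_series (fun n => Im (a n)) (Im l).
Proof.
unfold is_series; split.
- intros Hl; split; intros P [eps HP];
    generalize (Hl _ (locally_ball (l : C_UniformSpace) eps));
    unfold filtermap; apply filter_imp; intros n; rewrite sum_n_C;
    intros [H1 H2]; apply HP; assumption.
- intros [Hr Hi] P [eps HP].
  assert (A := Hr _ (locally_ball (Re l) eps)).
  assert (B := Hi _ (locally_ball (Im l) eps)).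
  unfold filtermap in *.
  generalize (filter_and _ _ A B); apply filter_imp; intros n [H1 H2].
  apply HP; rewrite sum_n_C; split; assumption.
Qed.

Lemma ex_series_C_lim_0 (a : nat -> C) :
  @ex_series C_AbsRing C_NormedModule a -> is_lim_seq (fun n => Cmod (a n)) 0.
Proof.
intros [l Hl]; apply is_series_C in Hl; destruct Hl as [Hlr Hli].
assert (Hr : ex_series (fun n => Re (a n))) by now exists (Re l).
assert (Hi : ex_series (fun n => Im (a n))) by now exists (Im l).
apply ex_series_lim_0, is_lim_seq_abs in Hr.
apply ex_series_lim_0, is_lim_seq_abs in Hi.
simpl in Hr, Hi; rewrite Rabs_R0 in Hr, Hi.
apply is_lim_seq_le_le with (fun _ => 0)
  (fun n => Rabs (Re (a n)) + Rabs (Im (a n))).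
- intros n; split; [apply Cmod_ge_0|].
  replace (a n) with (RtoC (Re (a n)) + Ci * RtoC (Im (a n)))%C at 1.
  + eapply Rle_trans; [apply Cmod_triangle|].
    rewrite Cmod_mult, !Cmod_R, Cmod_Ci; lra.
  + destruct (a n) as [r i]; unfold Ci, RtoC, Cplus, Cmult; simpl.
    f_equal; ring.
- apply is_lim_seq_const.
- replace (Finite 0) with (Finite (0 + 0)) by (f_equal; ring).
  now apply is_lim_seq_plus'.
Qed.

Lemma Rabs_Im_le_Cmod (z : C) : Rabs (Im z) <= Cmod z.
Proof.
eapply Rle_trans; [|apply Rmax_Cmod]; apply Rmax_r.
Qed.

(** * Dominated convergence and exchange of sums for real series *)

Lemma sum_n_pos_le (a : nat -> R) (l : R) (n : nat) :
  (forall k, 0 <= a k) -> is_series a l -> sum_n a n <= l.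
Proof.
intros Ha Hl.
apply (is_lim_seq_incr_compare (sum_n a) l Hl).
intros k; rewrite sum_Sn; unfold plus; simpl; specialize (Ha (S k)); lra.
Qed.

Lemma term_pos_le (a : nat -> R) (l : R) (n : nat) :
  (forall k, 0 <= a k) -> is_series a l -> a n <= l.
Proof.
intros Ha Hl; eapply Rle_trans; [|apply (sum_n_pos_le a l n Ha Hl)].
destruct n as [|n]; [rewrite sum_O; lra|].
rewrite sum_Sn; unfold plus; simpl.
enough (0 <= sum_n a n) by lra.
clear -Ha; induction n as [|n IH]; [now rewrite sum_O|].
rewrite sum_Sn; unfold plus; simpl; specialize (Ha (S n)); lra.
Qed.

Lemma ex_series_le_R (a b : nat -> R) :
  (forall n, Rabs (a n) <= b n) -> ex_series b -> ex_series a.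
Proof.
intros H; exact (ex_series_le (K := R_AbsRing) (V := R_CompleteNormedModule) a b H).
Qed.

(** An index [K] cuts the tail of [G], hence that of every [d N], below eps / 2; the head is a
    finite sum of sequences tending to 0. *)
Lemma dominated_series_0 (d : nat -> nat -> R) (G : nat -> R) :
  (forall N n, 0 <= d N n <= G n) -> ex_series G ->
  (forall n, is_lim_seq (fun N => d N n) 0) ->
  is_lim_seq (fun N => Series (d N)) 0.
Proof.
intros Hd HG Hl.
assert (Hex : forall N, ex_series (d N)).
{ intros N; apply ex_series_le_R with G; auto.
  intros n; destruct (Hd N n); rewrite Rabs_pos_eq; lra. }
assert (Hs : forall K, is_lim_seq (fun N => sum_f_R0 (d N) K) 0).
{ induction K as [|K IH]; simpl; [apply Hl|].
  replace (Finite 0) with (Finite (0 + 0)) by (f_equal; ring).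
  now apply is_lim_seq_plus'. }
assert (HT : is_lim_seq (fun K => Series G - sum_f_R0 G K) 0).
{ replace (Finite 0) with (Finite (Series G - Series G)) by (f_equal; ring).
  apply is_lim_seq_minus'; [apply is_lim_seq_const|].
  apply is_lim_seq_ext with (sum_n G); [intros; apply sum_n_Reals|].
  exact (Series_correct G HG). }
apply is_lim_seq_spec; intros eps.
assert (He : 0 < eps / 2) by (destruct eps; simpl; lra).
apply is_lim_seq_spec in HT.
destruct (HT (mkposreal _ He)) as [K HK]; specialize (HK K (le_n K)); simpl in HK.
specialize (Hs K); apply is_lim_seq_spec in Hs.
destruct (Hs (mkposreal _ He)) as [N0 HN]; exists N0; intros N HN0.
specialize (HN N HN0); simpl in HN.
(* Both series are split after [S K] terms, so that their heads are the sums up to [K] that occur in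
   [HK] and [HN]. *)
assert (E1 := Series_incr_n (d N) (S K) (Nat.lt_0_succ K) (Hex N)).
assert (E2 := Series_incr_n G (S K) (Nat.lt_0_succ K) HG).
simpl pred in E1, E2.
assert (E3 : Series (fun k => d N (S K + k)%nat) <= Series (fun k => G (S K + k)%nat)).
{ apply Series_le; [intros; apply Hd|].
  now apply (ex_series_incr_n (V := R_NormedModule) G (S K)). }
assert (E4 : 0 <= Series (d N)).
{ eapply Rle_trans; [apply (Hd N 0%nat)|].
  apply term_pos_le; [intros; apply Hd|apply Series_correct, Hex]. }
rewrite Rminus_0_r in *; rewrite Rabs_pos_eq by auto.
apply Rabs_def2 in HK; apply Rabs_def2 in HN; lra.
Qed.

(** Tannery's theorem. The bound [G] passes to the limit [h], and the differences, dominated by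
    [G + G], fall under [dominated_series_0]. *)
Lemma tannery_series (g : nat -> nat -> R) (G h : nat -> R) :
  (forall N n, Rabs (g N n) <= G n) -> ex_series G ->
  (forall n, is_lim_seq (fun N => g N n) (h n)) ->
  is_lim_seq (fun N => Series (g N)) (Series h).
Proof.
intros Hg HG Hl.
assert (Hh : forall n, Rabs (h n) <= G n).
{ intros n.
  apply (is_lim_seq_le (fun N => Rabs (g N n)) (fun _ => G n)
           (Rabs (h n)) (G n)); auto.
  - exact (is_lim_seq_abs _ _ (Hl n)).
  - apply is_lim_seq_const. }
assert (Hexg : forall N, ex_series (g N)) by (intros; now apply ex_series_le_R with G).
assert (Hexh : ex_series h) by now apply ex_series_le_R with G.
assert (H0 : is_lim_seq (fun N => Series (fun n => Rabs (g N n - h n))) 0).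
{ apply dominated_series_0 with (fun n => G n + G n).
  - intros N n; split; [apply Rabs_pos|].
    specialize (Hg N n); specialize (Hh n).
    assert (H := Rabs_triang (g N n) (- h n)); rewrite Rabs_Ropp in H.
    unfold Rminus; lra.
  - now apply (ex_series_plus (V := R_NormedModule)).
  - intros n; replace (Finite 0) with (Finite (Rabs (h n - h n)))
      by (f_equal; rewrite Rminus_diag; apply Rabs_R0).
    apply (is_lim_seq_abs (fun N => g N n - h n) (h n - h n)).
    apply is_lim_seq_minus'; [apply Hl|apply is_lim_seq_const]. }
assert (H1 : is_lim_seq (fun N => Series (g N) - Series h) 0).
{ apply is_lim_seq_abs_0.
  apply is_lim_seq_le_le with (fun _ => 0) (fun N => Series (fun n => Rabs (g N n - h n)));
    auto; [|apply is_lim_seq_const].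
  intros N; split; [apply Rabs_pos|].
  rewrite <- Series_minus by auto; apply Series_Rabs.
  apply ex_series_le_R with (fun n => G n + G n);
    [|now apply (ex_series_plus (V := R_NormedModule))].
  intros n; rewrite Rabs_Rabsolu.
  specialize (Hg N n); specialize (Hh n).
  assert (H := Rabs_triang (g N n) (- h n)); rewrite Rabs_Ropp in H.
  unfold Rminus; lra. }
apply is_lim_seq_ext with (fun N => (Series (g N) - Series h) + Series h); [intros; ring|].
replace (Finite (Series h)) with (Finite (0 + Series h)) by (f_equal; ring).
apply is_lim_seq_plus'; [auto|apply is_lim_seq_const].
Qed.

(** Partial sums over [j] move inside the series over [n]. As [k] is nonnegative they stay below
    [T n], so |c n| T n dominates and Tannery's theorem gives the limit. *)
Lemma series_exchange (c T : nat -> R) (k : nat -> nat -> R) :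
  (forall j n, 0 <= k j n) ->
  (forall n, is_series (fun j => k j n) (T n)) ->
  ex_series (fun n => Rabs (c n) * T n) ->
  is_series (fun j => Series (fun n => c n * k j n)) (Series (fun n => c n * T n)).
Proof.
intros Hk HS Hc.
assert (Hex : forall j, ex_series (fun n => c n * k j n)).
{ intros j; apply ex_series_le_R with (2 := Hc).
  intros n; rewrite Rabs_mult; apply Rmult_le_compat_l; [apply Rabs_pos|].
  rewrite Rabs_pos_eq by auto.
  apply (term_pos_le (fun j => k j n)); auto. }
assert (Hpos : forall J n, 0 <= sum_n (fun j => k j n) J).
{ induction J as [|J IH]; intros n; [now rewrite sum_O|].
  rewrite sum_Sn; unfold plus; simpl; specialize (IH n); specialize (Hk (S J) n); lra. }
assert (Hd : forall J n, Rabs (c n * sum_n (fun j => k j n) J) <= Rabs (c n) * T n).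
{ intros J n; rewrite Rabs_mult; apply Rmult_le_compat_l; [apply Rabs_pos|].
  rewrite Rabs_pos_eq by auto; apply sum_n_pos_le; auto. }
change (is_lim_seq (sum_n (fun j => Series (fun n => c n * k j n)))
  (Series (fun n => c n * T n))).
apply is_lim_seq_ext with (fun J => Series (fun n => c n * sum_n (fun j => k j n) J)).
- induction n as [|J IH].
  + rewrite sum_O; apply Series_ext; intros n; now rewrite sum_O.
  + rewrite sum_Sn, <- IH; unfold plus; simpl.
    rewrite <- Series_plus; auto.
    * apply Series_ext; intros n; rewrite sum_Sn; unfold plus; simpl; ring.
    * apply ex_series_le_R with (2 := Hc); apply Hd.
- apply tannery_series with (fun n => Rabs (c n) * T n); auto.
  intros n; apply (is_lim_seq_scal_l _ (c n) (T n)); exact (HS n).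
Qed.

(** * Bilateral real series *)

(** Real counterpart of [is_bilateral_series]: the two halves converge separately, with index 0 in
    the first. *)
Definition is_zseries (F : Z -> R) (l : R) : Prop :=
  exists lp ln : R,
    is_series (fun n => F (Z.of_nat n)) lp /\
    is_series (fun n => F (- Z.of_nat (S n))%Z) ln /\
    l = lp + ln.

Lemma is_zseries_ext (F G : Z -> R) (l : R) :
  (forall j, F j = G j) -> is_zseries F l -> is_zseries G l.
Proof.
intros H (lp & ln & Hp & Hn & E); exists lp, ln; repeat split; auto.
- revert Hp; now apply is_series_ext.
- revert Hn; now apply is_series_ext.
Qed.

Lemma is_zseries_unique (F : Z -> R) (l l' : R) :
  is_zseries F l -> is_zseries F l' -> l = l'.
Proof.
intros (lp & ln & Hp & Hn & ->) (lp' & ln' & Hp' & Hn' & ->).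
apply is_series_unique in Hp, Hn, Hp', Hn'; congruence.
Qed.

Lemma is_zseries_lin (F G : Z -> R) (a b l l' : R) :
  is_zseries F l -> is_zseries G l' ->
  is_zseries (fun j => a * F j + b * G j) (a * l + b * l').
Proof.
intros (lp & ln & Hp & Hn & ->) (lp' & ln' & Hp' & Hn' & ->).
exists (a * lp + b * lp'), (a * ln + b * ln'); repeat split; [| |ring].
- exact (is_series_plus _ _ _ _ (is_series_scal_l a _ _ Hp) (is_series_scal_l b _ _ Hp')).
- exact (is_series_plus _ _ _ _ (is_series_scal_l a _ _ Hn) (is_series_scal_l b _ _ Hn')).
Qed.

Lemma is_zseries_scal (F : Z -> R) (a l : R) :
  is_zseries F l -> is_zseries (fun j => a * F j) (a * l).
Proof.
intros H; generalize (is_zseries_lin F F a 0 l l H H).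
replace (a * l + 0 * l) with (a * l) by ring.
apply is_zseries_ext; intros; ring.
Qed.

(** The shift only moves the term [F (-1)] from the negative half to the other one. *)
Lemma is_zseries_pred (F : Z -> R) (l : R) :
  is_zseries F l -> is_zseries (fun j => F (j - 1)%Z) l.
Proof.
intros (lp & ln & Hp & Hn & ->).
exists (lp + F (-1)%Z), (ln - F (-1)%Z); repeat split; [| |ring].
- apply is_series_decr_1.
  replace (plus _ _) with lp by (unfold plus, opp; simpl; ring).
  revert Hp; apply is_series_ext; intros n; f_equal; lia.
- apply is_series_ext with (fun n => F (- Z.of_nat (S (S n)))%Z);
    [intros n; f_equal; lia|].
  apply is_series_incr_1 with (a := fun n => F (- Z.of_nat (S n))%Z).
  replace (plus _ _) with ln by (unfold plus; simpl; ring); exact Hn.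
Qed.

Lemma is_zseries_succ (F : Z -> R) (l : R) :
  is_zseries F l -> is_zseries (fun j => F (j + 1)%Z) l.
Proof.
intros (lp & ln & Hp & Hn & ->).
exists (lp - F 0%Z), (ln + F 0%Z); repeat split; [| |ring].
- apply is_series_ext with (fun n => F (Z.of_nat (S n))); [intros n; f_equal; lia|].
  apply is_series_incr_1 with (a := fun n => F (Z.of_nat n)).
  replace (plus _ _) with lp by (unfold plus; simpl; ring); exact Hp.
- apply is_series_decr_1.
  replace (plus _ _) with ln by (unfold plus, opp; simpl; ring).
  revert Hn; apply is_series_ext; intros n; f_equal; lia.
Qed.

(** Tannery's theorem on each half: the sums [s N] tend both to [l] and to the sum of the [H j], and
    limits are unique. *)
Lemma tannery_zseries (F : nat -> Z -> R) (G H : Z -> R) (s : nat -> R) (l lG : R) :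
  (forall N j, Rabs (F N j) <= G j) -> is_zseries G lG ->
  (forall j, is_lim_seq (fun N => F N j) (H j)) ->
  (forall N, is_zseries (F N) (s N)) -> is_lim_seq s l ->
  is_zseries H l.
Proof.
intros Hd (gp & gn & HGp & HGn & _) Hl HF Hs.
assert (Hh : forall j, Rabs (H j) <= G j).
{ intros j.
  apply (is_lim_seq_le (fun N => Rabs (F N j)) (fun _ => G j)
           (Rabs (H j)) (G j)); auto.
  - exact (is_lim_seq_abs _ _ (Hl j)).
  - apply is_lim_seq_const. }
exists (Series (fun n => H (Z.of_nat n))), (Series (fun n => H (- Z.of_nat (S n))%Z)).
repeat split.
- apply Series_correct, ex_series_le_R with (fun n => G (Z.of_nat n)); auto.
  now exists gp.
- apply Series_correct, ex_series_le_R with (fun n => G (- Z.of_nat (S n))%Z); auto.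
  now exists gn.
- enough (E : Finite l = Finite (Series (fun n => H (Z.of_nat n)) +
              Series (fun n => H (- Z.of_nat (S n))%Z))) by congruence.
  rewrite <- (is_lim_seq_unique _ _ Hs); apply is_lim_seq_unique.
  apply is_lim_seq_ext with (fun N => Series (fun n => F N (Z.of_nat n)) +
     Series (fun n => F N (- Z.of_nat (S n))%Z)).
  + intros N; destruct (HF N) as (lp & ln & Hp & Hn & ->).
    apply is_series_unique in Hp, Hn; congruence.
  + apply is_lim_seq_plus'.
    * apply tannery_series with (fun n => G (Z.of_nat n)); auto; now exists gp.
    * apply tannery_series with (fun n => G (- Z.of_nat (S n))%Z); auto; now exists gn.
Qed.

(** Nonnegative terms put both half sums [Tp n] and [Tn n] between 0 and [T n], so summability
    passes to each half, where [series_exchange] applies. *)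
Lemma zseries_exchange (c T : nat -> R) (k : Z -> nat -> R) :
  (forall j n, 0 <= k j n) ->
  (forall n, is_zseries (fun j => k j n) (T n)) ->
  ex_series (fun n => Rabs (c n) * T n) ->
  is_zseries (fun j => Series (fun n => c n * k j n)) (Series (fun n => c n * T n)).
Proof.
intros Hk HS Hc.
set (Tp := fun n => Series (fun j => k (Z.of_nat j) n)).
set (Tn := fun n => Series (fun j => k (- Z.of_nat (S j))%Z n)).
assert (H : forall n, is_series (fun j => k (Z.of_nat j) n) (Tp n) /\
   is_series (fun j => k (- Z.of_nat (S j))%Z n) (Tn n) /\
   T n = Tp n + Tn n /\ 0 <= Tp n /\ 0 <= Tn n).
{ intros n; destruct (HS n) as (lp & ln & Hp & Hn & E).
  unfold Tp, Tn; rewrite (is_series_unique _ _ Hp), (is_series_unique _ _ Hn).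
  repeat split; auto.
  - eapply Rle_trans; [|apply (term_pos_le _ _ 0%nat (fun j => Hk _ n) Hp)]; apply Hk.
  - eapply Rle_trans; [|apply (term_pos_le _ _ 0%nat (fun j => Hk _ n) Hn)]; apply Hk. }
assert (Hcp : ex_series (fun n => Rabs (c n) * Tp n)).
{ apply ex_series_le_R with (2 := Hc); intros n.
  destruct (H n) as (_ & _ & E & H1 & H2).
  rewrite Rabs_mult, Rabs_Rabsolu, (Rabs_pos_eq (Tp n)) by auto.
  apply Rmult_le_compat_l; [apply Rabs_pos|lra]. }
assert (Hcn : ex_series (fun n => Rabs (c n) * Tn n)).
{ apply ex_series_le_R with (2 := Hc); intros n.
  destruct (H n) as (_ & _ & E & H1 & H2).
  rewrite Rabs_mult, Rabs_Rabsolu, (Rabs_pos_eq (Tn n)) by auto.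
  apply Rmult_le_compat_l; [apply Rabs_pos|lra]. }
exists (Series (fun n => c n * Tp n)), (Series (fun n => c n * Tn n)); repeat split.
- assert (H1 : forall n, is_series (fun j => k (Z.of_nat j) n) (Tp n)) by (intros n; now destruct (H n)).
  exact (series_exchange c Tp (fun j n => k (Z.of_nat j) n) (fun j n => Hk _ n) H1 Hcp).
- assert (H1 : forall n, is_series (fun j => k (- Z.of_nat (S j))%Z n) (Tn n)) by (intros n; now destruct (H n)).
  exact (series_exchange c Tn (fun j n => k (- Z.of_nat (S j))%Z n) (fun j n => Hk _ n) H1 Hcn).
- rewrite <- Series_plus.
  + apply Series_ext; intros n; destruct (H n) as (_ & _ & -> & _); ring.
  + apply ex_series_le_R with (2 := Hcp); intros n; rewrite Rabs_mult.
    rewrite (Rabs_pos_eq (Tp n)) by apply H; lra.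
  + apply ex_series_le_R with (2 := Hcn); intros n; rewrite Rabs_mult.
    rewrite (Rabs_pos_eq (Tn n)) by apply H; lra.
Qed.

(** * Bounds on finite q-Pochhammer symbols *)

Lemma pow_le_1 (q : R) (n : nat) : 0 < q < 1 -> 0 < q ^ n <= 1.
Proof.
intros Hq; split; [apply pow_lt; lra|].
rewrite <- (pow1 n); apply pow_incr; lra.
Qed.

Lemma mult_pow_lt_1 (q a : R) (n : nat) : 0 < q < 1 -> a < 1 -> a * q ^ n < 1.
Proof.
intros Hq Ha; assert (H := pow_le_1 q n Hq).
assert (0 < (1 - a) * q ^ n) by (apply Rmult_lt_0_compat; lra); lra.
Qed.

Lemma is_lim_seq_scal_pow (a q : R) : 0 < q < 1 -> is_lim_seq (fun n => a * q ^ n) 0.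
Proof.
intros Hq; replace (Finite 0) with (Rbar_mult a (Finite 0)) by (simpl; f_equal; ring).
apply is_lim_seq_scal_l, is_lim_seq_geom; rewrite Rabs_pos_eq; lra.
Qed.

Lemma Cqpoch_RtoC (q a : R) (n : nat) : Cqpoch q (RtoC a) n = RtoC (qpoch q a n).
Proof.
induction n as [|n IH]; [reflexivity|].
simpl; now rewrite IH, RtoC_mult, RtoC_minus, RtoC_mult.
Qed.

(** Each factor has modulus at most 1 + |a| q^i <= exp(|a| q^i), and the exponents form a geometric
    series. *)
Lemma Cqpoch_le (q : R) (a : C) (n : nat) : 0 < q < 1 ->
  Cmod (Cqpoch q a n) <= exp (Cmod a / (1 - q)).
Proof.
intros Hq.
assert (H : Cmod (Cqpoch q a n) <= exp (Cmod a * (1 - q ^ n) / (1 - q))).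
{ induction n as [|n IH].
  - simpl; rewrite Cmod_1; replace (_ / _) with 0 by (field; lra); rewrite exp_0; lra.
  - simpl Cqpoch; rewrite Cmod_mult.
    replace (Cmod a * (1 - q ^ S n) / (1 - q))
      with (Cmod a * (1 - q ^ n) / (1 - q) + Cmod a * q ^ n) by (simpl; field; lra).
    rewrite exp_plus; apply Rmult_le_compat; auto using Cmod_ge_0.
    eapply Rle_trans; [apply Cmod_triangle|].
    rewrite Cmod_opp, Cmod_mult, Cmod_1, Cmod_R, Rabs_pos_eq
      by (left; now apply pow_le_1).
    apply exp_ineq1_le. }
eapply Rle_trans; [exact H|].
assert (Hle : Cmod a * (1 - q ^ n) / (1 - q) <= Cmod a / (1 - q)).
{ apply Rmult_le_compat_r; [left; apply Rinv_0_lt_compat; lra|].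
  rewrite <- (Rmult_1_r (Cmod a)) at 2; apply Rmult_le_compat_l; [apply Cmod_ge_0|].
  generalize (pow_le_1 q n Hq); lra. }
destruct Hle as [Hlt | ->]; [left; now apply exp_increasing|lra].
Qed.

(** Only finitely many values precede the threshold [N]; the induction absorbs them one at a time by
    taking a minimum. *)
Lemma pos_lower_bound (f : nat -> R) (N : nat) (c : R) :
  (forall n, 0 < f n) -> 0 < c -> (forall n, (N <= n)%nat -> c <= f n) ->
  exists c', 0 < c' /\ forall n, c' <= f n.
Proof.
intros Hf; revert c; induction N as [|N IH]; intros c Hc H.
- exists c; split; auto; intros n; apply H; lia.
- apply (IH (Rmin c (f N))); [now apply Rmin_glb_lt|].
  intros n Hn; destruct (Nat.eq_dec n N) as [->|Hne]; [apply Rmin_r|].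
  eapply Rle_trans; [apply Rmin_l|]; apply H; lia.
Qed.

(* The lower bound rests on (1 - y_1) ... (1 - y_n) >= 1 - (y_1 + ... + y_n). *)
Lemma Cqpoch_ge (q : R) (a : C) : 0 < q < 1 ->
  (forall n, Cqpoch q a n <> RtoC 0) ->
  exists c, 0 < c /\ forall n, c <= Cmod (Cqpoch q a n).
Proof.
intros Hq Ha.
assert (Hl := is_lim_seq_scal_pow (Cmod a) q Hq).
apply is_lim_seq_spec in Hl.
(* With |a| q^N < (1 - q) / 2 the geometric tail |a| q^N / (1 - q) stays below 1/2, so at least half
   of the modulus reached at [N] survives. *)
assert (He : 0 < (1 - q) / 2) by lra.
destruct (Hl (mkposreal _ He)) as [N HN]; specialize (HN N (le_n N)); simpl in HN.
rewrite Rminus_0_r in HN; apply Rabs_def2 in HN; destruct HN as [HN _].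
assert (HP : forall n, 0 < Cmod (Cqpoch q a n)) by (intros; now apply Cmod_gt_0).
assert (H : forall n, Cmod (Cqpoch q a N) * (1 - Cmod a * q ^ N * (1 - q ^ n) / (1 - q))
          <= Cmod (Cqpoch q a (N + n))).
{ induction n as [|n IH].
  - rewrite Nat.add_0_r; simpl; right; field; lra.
  - rewrite Nat.add_succ_r; simpl Cqpoch; rewrite Cmod_mult.
    assert (Hy : 1 - Cmod a * q ^ (N + n) <= Cmod (1 - a * RtoC (q ^ (N + n)))).
    { assert (T := Cmod_triangle (1 - a * RtoC (q ^ (N + n))) (a * RtoC (q ^ (N + n)))).
      replace (_ + _)%C with (RtoC 1) in T by ring.
      rewrite Cmod_1, Cmod_mult, Cmod_R, Rabs_pos_eq in T
        by (left; now apply pow_le_1); lra. }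
    set (X := Cmod a * q ^ N * (1 - q ^ n) / (1 - q)) in *.
    set (y := Cmod a * q ^ (N + n)) in *.
    replace (Cmod a * q ^ N * (1 - q ^ S n) / (1 - q)) with (X + y)
      by (unfold X, y; rewrite pow_add; simpl; field; lra).
    assert (Hq1 := pow_le_1 q n Hq); assert (Hq2 := pow_le_1 q N Hq).
    assert (Ca := Cmod_ge_0 a).
    assert (HX0 : 0 <= X).
    { unfold X; apply Rmult_le_pos; [|left; apply Rinv_0_lt_compat; lra].
      apply Rmult_le_pos; [apply Rmult_le_pos; lra|lra]. }
    assert (Hy0 : 0 <= y) by (apply Rmult_le_pos; [lra|left; now apply pow_le_1]).
    assert (Hy1 : y <= 1).
    { unfold y; rewrite pow_add, <- Rmult_assoc.
      assert (Cmod a * q ^ N * q ^ n <= Cmod a * q ^ N * 1); [|lra].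
      apply Rmult_le_compat_l; [apply Rmult_le_pos; lra|lra]. }
    apply Rle_trans with (Cmod (Cqpoch q a N) * (1 - X) * (1 - y)).
    + rewrite Rmult_assoc; apply Rmult_le_compat_l; [apply Cmod_ge_0|nra].
    + apply Rle_trans with (Cmod (Cqpoch q a (N + n)) * (1 - y)).
      * apply Rmult_le_compat_r; lra.
      * apply Rmult_le_compat_l; [apply Cmod_ge_0|auto]. }
apply (pos_lower_bound _ N (Cmod (Cqpoch q a N) * / 2)); auto.
- specialize (HP N); lra.
- intros n Hn; replace n with (N + (n - N))%nat by lia.
  eapply Rle_trans; [|apply H].
  apply Rmult_le_compat_l; [apply Cmod_ge_0|].
  assert (Hq1 := pow_le_1 q (n - N) Hq).
  assert (Cmod a * q ^ N * (1 - q ^ (n - N)) / (1 - q) <= / 2); [|lra].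
  apply Rmult_le_reg_r with (1 - q); [lra|].
  unfold Rdiv; rewrite Rmult_assoc, Rinv_l, Rmult_1_r by lra.
  assert (Ca : 0 <= Cmod a * q ^ N)
    by (apply Rmult_le_pos; [apply Cmod_ge_0|left; now apply pow_le_1]).
  apply Rle_trans with (Cmod a * q ^ N * 1); [apply Rmult_le_compat_l; lra|lra].
Qed.

(** * Infinite q-products *)

Lemma qpoch_pos (q a : R) (n : nat) : 0 < q < 1 -> a < 1 -> 0 < qpoch q a n.
Proof.
intros Hq Ha; induction n as [|n IH]; simpl; [lra|].
apply Rmult_lt_0_compat; auto.
generalize (mult_pow_lt_1 q a n Hq Ha); lra.
Qed.

(** For a <= 0 the products increase and obey the exponential bound of [Cqpoch_le]; for 0 < a < 1
    they decrease and stay positive. Hence the limit behind [qpoch_inf] is finite and [real] loses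
    nothing. *)
Lemma qpoch_inf_lim (q a : R) : 0 < q < 1 -> a < 1 ->
  is_lim_seq (qpoch q a) (qpoch_inf q a).
Proof.
intros Hq Ha.
assert (Hex : ex_finite_lim_seq (qpoch q a)).
{ destruct (Rle_dec a 0) as [Ha0|Ha0].
  - apply ex_finite_lim_seq_incr with (exp (Cmod (RtoC a) / (1 - q))).
    + intros n; assert (P := qpoch_pos q a n Hq Ha); simpl.
      assert (H := pow_le_1 q n Hq); assert (0 <= - a * q ^ n) by nra; nra.
    + intros n; rewrite <- (Rabs_pos_eq (qpoch q a n)) by (left; now apply qpoch_pos).
      rewrite <- Cmod_R, <- Cqpoch_RtoC; now apply Cqpoch_le.
  - apply ex_finite_lim_seq_decr with 0.
    + intros n; assert (P := qpoch_pos q a n Hq Ha); simpl.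
      assert (H := pow_le_1 q n Hq); assert (0 <= a * q ^ n) by nra; nra.
    + intros n; left; now apply qpoch_pos. }
exact (Lim_seq_correct' _ Hex).
Qed.

(** Positive factors alone would allow the limit 0; the uniform lower bound of [Cqpoch_ge] excludes
    it. *)
Lemma qpoch_inf_pos (q a : R) : 0 < q < 1 -> a < 1 -> 0 < qpoch_inf q a.
Proof.
intros Hq Ha.
destruct (Cqpoch_ge q (RtoC a) Hq) as (c & Hc & H).
- intros n; rewrite Cqpoch_RtoC; intros E; apply RtoC_inj in E.
  generalize (qpoch_pos q a n Hq Ha); lra.
- apply Rlt_le_trans with c; auto.
  apply (is_lim_seq_le (fun _ => c) (qpoch q a) c (qpoch_inf q a)).
  + intros n; rewrite <- (Rabs_pos_eq (qpoch q a n)) by (left; now apply qpoch_pos).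
    now rewrite <- Cmod_R, <- Cqpoch_RtoC.
  + apply is_lim_seq_const.
  + now apply qpoch_inf_lim.
Qed.

Lemma qpoch_shift (q a : R) (n : nat) : qpoch q a (S n) = (1 - a) * qpoch q (a * q) n.
Proof.
induction n as [|n IH]; [simpl; ring|].
change (qpoch q a (S n) * (1 - a * q ^ S n)
  = (1 - a) * (qpoch q (a * q) n * (1 - a * q * q ^ n))).
rewrite IH; simpl; ring.
Qed.

Lemma qpoch_inf_shift (q a : R) : 0 < q < 1 -> a < 1 ->
  qpoch_inf q a = (1 - a) * qpoch_inf q (a * q).
Proof.
intros Hq Ha.
assert (Haq : a * q < 1) by nra.
enough (E : Finite (qpoch_inf q a) = Finite ((1 - a) * qpoch_inf q (a * q))) by congruence.
rewrite <- (is_lim_seq_unique _ _ (proj1 (is_lim_seq_incr_1 _ _) (qpoch_inf_lim q a Hq Ha))).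
apply is_lim_seq_unique.
apply is_lim_seq_ext with (fun n => (1 - a) * qpoch q (a * q) n);
  [intros; now rewrite qpoch_shift|].
apply (is_lim_seq_scal_l _ (1 - a) (qpoch_inf q (a * q))); now apply qpoch_inf_lim.
Qed.

Lemma qpoch_inf_split (q a : R) (n : nat) : 0 < q < 1 -> a < 1 ->
  qpoch_inf q a = qpoch q a n * qpoch_inf q (a * q ^ n).
Proof.
intros Hq Ha; induction n as [|n IH]; simpl.
- now rewrite Rmult_1_l, Rmult_1_r.
- rewrite IH, Rmult_assoc; f_equal.
  rewrite (qpoch_inf_shift q (a * q ^ n)) by auto using mult_pow_lt_1.
  do 2 f_equal; ring.
Qed.

Lemma qpoch_neg_ge1 (q a : R) (n : nat) : 0 < q < 1 -> a <= 0 -> 1 <= qpoch q a n.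
Proof.
intros Hq Ha; induction n as [|n IH]; simpl; [lra|].
assert (H := pow_le_1 q n Hq); assert (0 <= - a * q ^ n) by nra; nra.
Qed.

(** The first factor is 1 - a and all others are at least 1. *)
Lemma qpoch_inf_ge (q a : R) : 0 < q < 1 -> a <= 0 -> 1 - a <= qpoch_inf q a.
Proof.
intros Hq Ha; rewrite qpoch_inf_shift by lra.
assert (1 <= qpoch_inf q (a * q)); [|nra].
apply (is_lim_seq_le (fun _ => 1) (qpoch q (a * q)) 1 (qpoch_inf q (a * q))).
- intros n; apply qpoch_neg_ge1; auto; nra.
- apply is_lim_seq_const.
- apply qpoch_inf_lim; auto; nra.
Qed.

Lemma qpoch_inf_pow_lim (q a : R) : 0 < q < 1 -> a < 1 ->
  is_lim_seq (fun n => qpoch_inf q (a * q ^ n)) 1.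
Proof.
intros Hq Ha; assert (P := qpoch_inf_pos q a Hq Ha).
apply is_lim_seq_ext with (fun n => qpoch_inf q a / qpoch q a n).
- intros n; rewrite (qpoch_inf_split q a n Hq Ha) at 1.
  assert (H := qpoch_pos q a n Hq Ha); field; lra.
- replace (Finite 1) with (Finite (qpoch_inf q a / qpoch_inf q a)) by (f_equal; field; lra).
  apply is_lim_seq_div'; [apply is_lim_seq_const|now apply qpoch_inf_lim|lra].
Qed.

(** * The theta function *)

Definition pinf (q y : R) : R := qpoch_inf q (- y).

Lemma pinf_ge (q y : R) : 0 < q < 1 -> 0 <= y -> 1 + y <= pinf q y.
Proof.
intros Hq Hy; unfold pinf; generalize (qpoch_inf_ge q (- y) Hq); lra.
Qed.

Lemma pinf_shift (q y : R) : 0 < q < 1 -> 0 <= y ->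
  pinf q y = (1 + y) * pinf q (y * q).
Proof.
intros Hq Hy; unfold pinf; rewrite qpoch_inf_shift by lra.
f_equal; [ring|f_equal; ring].
Qed.

(** By Jacobi's triple product, (q; q)_oo theta(x) is the sum over n in Z of q^(n choose 2) x^n. *)
Definition theta (q x : R) : R := pinf q x * pinf q (q / x).

Lemma theta_pos (q x : R) : 0 < q < 1 -> 0 < x -> 0 < theta q x.
Proof.
intros Hq Hx; assert (0 < q / x) by (apply Rdiv_lt_0_compat; lra).
apply Rmult_lt_0_compat.
- generalize (pinf_ge q x Hq); lra.
- generalize (pinf_ge q (q / x) Hq); lra.
Qed.

(** Passing from x to xq removes the factor 1 + x from the first product and adds 1 + 1/x to the
    second; their quotient is 1/x. *)
Lemma theta_shift (q x : R) : 0 < q < 1 -> 0 < x ->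
  theta q (x * q) = theta q x / x.
Proof.
intros Hq Hx; unfold theta.
assert (0 < / x) by (now apply Rinv_0_lt_compat).
rewrite (pinf_shift q x) by lra.
replace (q / (x * q)) with (/ x) by (field; lra).
rewrite (pinf_shift q (/ x)) by lra.
replace (/ x * q) with (q / x) by (field; lra).
field; lra.
Qed.

(** * The bilateral sum S(z): functional equation and convergence *)

(** Up to the constant 1 / (-x; q)_oo, the general term of the bilateral series 1psi1 with upper
    parameter -x and lower parameter 0. *)
Definition psi_term (q x z : R) (j : Z) : R :=
  powerRZ z j / pinf q (x * powerRZ q j).

Lemma powerRZ_succ (x : R) (j : Z) : x <> 0 -> powerRZ x (j + 1) = powerRZ x j * x.
Proof.
intros Hx; rewrite powerRZ_add by auto; now rewrite powerRZ_1.
Qed.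

Lemma psi_term_pos (q x z : R) (j : Z) : 0 < q < 1 -> 0 < x -> 0 < z ->
  0 < psi_term q x z j.
Proof.
intros Hq Hx Hz.
assert (0 < x * powerRZ q j) by (apply Rmult_lt_0_compat; auto; apply powerRZ_lt; lra).
apply Rdiv_lt_0_compat; [now apply powerRZ_lt|].
generalize (pinf_ge q (x * powerRZ q j) Hq); lra.
Qed.

Lemma psi_term_succ (q x z : R) (j : Z) : 0 < q < 1 -> 0 < x -> 0 < z ->
  psi_term q x z (j + 1) = z * (1 + x * powerRZ q j) * psi_term q x z j.
Proof.
intros Hq Hx Hz; unfold psi_term; rewrite !powerRZ_succ by lra.
assert (H : 0 < x * powerRZ q j) by (apply Rmult_lt_0_compat; auto; apply powerRZ_lt; lra).
rewrite (pinf_shift q (x * powerRZ q j)) by lra.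
rewrite <- Rmult_assoc.
assert (H1 : 0 <= x * powerRZ q j * q) by (apply Rmult_le_pos; lra).
generalize (pinf_ge q _ Hq H1); intros H2.
field; split; lra.
Qed.

Lemma psi_term_scal (q x z : R) (j : Z) :
  psi_term q x (z * q) j = powerRZ q j * psi_term q x z j.
Proof.
unfold psi_term; rewrite powerRZ_mult; unfold Rdiv; ring.
Qed.

(** By [psi_term_succ] the shifted series is z times the original plus zx times the series at zq,
    and a shift preserves the sum. Convergence at zq comes out as well. *)
Lemma psi_step (q x z l : R) : 0 < q < 1 -> 0 < x -> 0 < z ->
  is_zseries (psi_term q x z) l ->
  is_zseries (psi_term q x (z * q)) (l * (1 - z) / (z * x)).
Proof.
intros Hq Hx Hz Hl.
generalize (is_zseries_lin _ _ (/ (z * x)) (- / x) _ _ (is_zseries_succ _ _ Hl) Hl).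
replace (l * (1 - z) / (z * x)) with (/ (z * x) * l + - / x * l) by (field; lra).
apply is_zseries_ext; intros j.
rewrite psi_term_succ, psi_term_scal by auto; field; lra.
Qed.

(** Towards plus infinity the terms are at most z^n, since [pinf] is at least 1 there; towards minus
    infinity the ratio test applies with limit 0. *)
Lemma psi_ex (q x z : R) : 0 < q < 1 -> 0 < x -> 0 < z < 1 ->
  exists l, is_zseries (psi_term q x z) l.
Proof.
intros Hq Hx Hz.
assert (Hpos : forall j, 0 < psi_term q x z j) by (intros; apply psi_term_pos; lra).
assert (Hp : ex_series (fun n => psi_term q x z (Z.of_nat n))).
{ apply ex_series_le_R with (fun n => z ^ n).
  - intros n; rewrite Rabs_pos_eq by (left; auto).
    unfold psi_term; rewrite <- !pow_powerRZ.
    assert (H1 : 0 < x * q ^ n) by (apply Rmult_lt_0_compat; auto; now apply pow_le_1).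
    assert (H2 := pinf_ge q (x * q ^ n) Hq (Rlt_le _ _ H1)).
    assert (H3 : 0 < z ^ n) by (apply pow_lt; lra).
    apply Rmult_le_reg_r with (pinf q (x * q ^ n)); [lra|].
    unfold Rdiv; rewrite Rmult_assoc, Rinv_l by lra.
    apply Rmult_le_compat_l; lra.
  - apply ex_series_geom; rewrite Rabs_pos_eq; lra. }
assert (Hn : ex_series (fun n => psi_term q x z (- Z.of_nat (S n))%Z)).
{ apply ex_series_Rabs, ex_series_DAlembert with 0; [lra| |].
  - intros n; generalize (Hpos (- Z.of_nat (S n))%Z); lra.
  (* The ratio of consecutive terms is 1 / (z (1 + x q^(-n-2))), which is below q^(n+2) / (zx). *)
  - apply is_lim_seq_le_le with (fun _ => 0) (fun n => q ^ 2 / (z * x) * q ^ n);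
      [|apply is_lim_seq_const|now apply is_lim_seq_scal_pow].
    intros n; split; [apply Rabs_pos|].
    set (j := (- Z.of_nat (S (S n)))%Z).
    assert (Pj := Hpos j).
    replace (- Z.of_nat (S n))%Z with (j + 1)%Z by (unfold j; lia).
    rewrite psi_term_succ by lra.
    assert (Hj : powerRZ q j = / q ^ (S (S n)))
      by (unfold j; now rewrite powerRZ_neg', <- pow_powerRZ).
    rewrite Hj; assert (Hqn := pow_le_1 q n Hq).
    replace (psi_term q x z j / _) with (q ^ 2 * q ^ n / (z * (q ^ 2 * q ^ n + x)))
      by (simpl; field; repeat split; try nra; apply Rgt_not_eq; 
          repeat apply Rmult_lt_0_compat; try nra).
    assert (Hm : 0 < q ^ 2 * q ^ n) by (apply Rmult_lt_0_compat; nra).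
    assert (Hzx : 0 < z * x) by nra.
    rewrite Rabs_pos_eq.
    + replace (q ^ 2 / (z * x) * q ^ n) with (q ^ 2 * q ^ n / (z * x)) by (field; lra).
      apply Rmult_le_compat_l; [lra|apply Rinv_le_contravar; nra].
    + apply Rmult_le_pos; [lra|left; apply Rinv_0_lt_compat; nra]. }
destruct Hp as [lp Hp], Hn as [ln Hn]; exists (lp + ln); exists lp, ln; auto.
Qed.

(** * Evaluation of S(z) *)

Lemma is_series_telescope (u : nat -> R) (l : R) :
  is_lim_seq u l -> is_series (fun n => u (S n) - u n) (l - u 0%nat).
Proof.
intros H.
change (is_lim_seq (sum_n (fun n => u (S n) - u n)) (l - u 0%nat)).
apply is_lim_seq_ext with (fun n => u (S n) - u 0%nat).
- induction n as [|n IH]; [now rewrite sum_O|].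
  rewrite sum_Sn, <- IH; unfold plus; simpl; ring.
- apply is_lim_seq_minus'; [now apply -> is_lim_seq_incr_1|apply is_lim_seq_const].
Qed.

(* Telescoping: [x q^j / pinf (x q^j) = 1 / pinf (x q^(j+1)) - 1 / pinf (x q^j)]. *)
Lemma psi_q (q x : R) : 0 < q < 1 -> 0 < x -> is_zseries (psi_term q x q) (/ x).
Proof.
intros Hq Hx.
(* At z = 1 the terms are 1 / [pinf] (x q^j), with limit 1 at plus infinity and 0 at minus infinity,
   so their differences sum to 1. *)
set (E := psi_term q x 1).
assert (H1 : is_lim_seq (fun n => E (Z.of_nat n)) 1).
{ apply is_lim_seq_ext with (fun n => 1 / qpoch_inf q (- x * q ^ n)).
  - intros n; unfold E, psi_term, pinf.
    rewrite powerRZ_R1, <- pow_powerRZ; do 2 f_equal; ring.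
  - replace (Finite 1) with (Finite (1 / 1)) by (f_equal; field).
    apply is_lim_seq_div'; [apply is_lim_seq_const| |lra].
    apply qpoch_inf_pow_lim; lra. }
assert (H0 : is_lim_seq (fun n => E (- Z.of_nat n)%Z) 0).
{ apply is_lim_seq_le_le with (fun _ => 0) (fun n => / x * q ^ n);
    [|apply is_lim_seq_const|now apply is_lim_seq_scal_pow].
  intros n; split; [left; apply psi_term_pos; lra|].
  unfold E, psi_term; rewrite powerRZ_R1, powerRZ_neg', <- pow_powerRZ.
  assert (Hqn := pow_le_1 q n Hq).
  assert (P : 0 < x * / q ^ n) by (apply Rmult_lt_0_compat; auto; now apply Rinv_0_lt_compat).
  assert (Hp := pinf_ge q (x * / q ^ n) Hq (Rlt_le _ _ P)).
  replace (/ x * q ^ n) with (/ (x * / q ^ n)) by (field; lra).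
  unfold Rdiv; rewrite Rmult_1_l; apply Rinv_le_contravar; lra. }
assert (HE : is_zseries (fun j => E (j + 1)%Z - E j) 1).
{ exists (1 - E 0%Z), (E 0%Z - 0); repeat split; [| |ring].
  - generalize (is_series_telescope _ _ H1); apply is_series_ext.
    intros n; do 2 f_equal; lia.
  - generalize (is_series_opp _ _ (is_series_telescope _ _ H0)).
    replace (opp _) with (E 0%Z - 0) by (unfold opp; simpl; ring).
    apply is_series_ext; intros n.
    replace (- Z.of_nat (S n) + 1)%Z with (- Z.of_nat n)%Z by lia.
    unfold opp; simpl; ring. }
generalize (is_zseries_scal _ (/ x) _ HE); rewrite Rmult_1_r.
apply is_zseries_ext; intros j; unfold E.
rewrite psi_term_succ by lra.
replace (psi_term q x q j) with (psi_term q x (1 * q) j) by now rewrite Rmult_1_l.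
rewrite psi_term_scal; field; lra.
Qed.

(* Shifting [j] by [n] in the series of [psi_term q x (z * q ^ n)] and multiplying by
   [z ^ n * x ^ n * q ^ (n choose 2)] gives these terms, which have a
   termwise limit as [n] tends to infinity. *)
Definition psi_trunc (q x z : R) (n : nat) (j : Z) : R :=
  powerRZ z j / (pinf q (x * powerRZ q j) * qpoch q (- (q / (x * powerRZ q j))) n).

(** With y = x q^(j-1), the symbol (-1/y; q)_(n+1) factors both as (1 + 1/y) (-q/y; q)_n and as
    (-1/y; q)_n (1 + q^n/y); comparing the two gives the recurrence. *)
Lemma psi_trunc_succ (q x z : R) (n : nat) (j : Z) : 0 < q < 1 -> 0 < x -> 0 < z ->
  psi_trunc q x z (S n) j = psi_trunc q x z n j - z * q ^ n * psi_trunc q x z n (j - 1).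
Proof.
intros Hq Hx Hz; unfold psi_trunc.
set (y := x * powerRZ q (j - 1)).
assert (Hy : 0 < y) by (apply Rmult_lt_0_compat; auto; apply powerRZ_lt; lra).
assert (Ej : x * powerRZ q j = y * q).
{ unfold y; replace j with (j - 1 + 1)%Z at 1 by lia.
  rewrite powerRZ_succ by lra; ring. }
assert (Zj : powerRZ z j = powerRZ z (j - 1) * z).
{ replace j with (j - 1 + 1)%Z at 1 by lia; rewrite powerRZ_succ by lra; ring. }
rewrite Ej, Zj, (pinf_shift q y) by lra.
replace (q / (y * q)) with (/ y) by (field; lra).
assert (Hiy : 0 < / y) by now apply Rinv_0_lt_compat.
assert (Hyq : 0 < q / y) by (apply Rdiv_lt_0_compat; lra).
assert (E := qpoch_shift q (- / y) n); simpl in E.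
replace (- / y * q) with (- (q / y)) in E by (field; lra).
assert (P1 := qpoch_pos q (- / y) n Hq ltac:(lra)).
assert (P2 := qpoch_pos q (- (q / y)) n Hq ltac:(lra)).
assert (Hyq' : 0 <= y * q) by nra.
assert (P3 := pinf_ge q (y * q) Hq Hyq').
assert (Hqn := pow_le_1 q n Hq).
simpl; set (A := qpoch q (- / y) n) in *; set (B := qpoch q (- (q / y)) n) in *.
assert (EB : B = A * (1 - - / y * q ^ n) / (1 - - / y)) by (rewrite E; field; lra).
rewrite EB; field.
repeat split; try lra.
Qed.

(** Each step subtracts z q^n times a shifted copy with the same sum, so the total gains the factor
    1 - z q^n. *)
Lemma psi_trunc_sum (q x z l : R) (n : nat) : 0 < q < 1 -> 0 < x -> 0 < z ->
  is_zseries (psi_term q x z) l ->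
  is_zseries (psi_trunc q x z n) (l * qpoch q z n).
Proof.
intros Hq Hx Hz Hl; induction n as [|n IH].
- simpl; rewrite Rmult_1_r; revert Hl; apply is_zseries_ext; intros j.
  unfold psi_trunc, psi_term; simpl; now rewrite Rmult_1_r.
- generalize (is_zseries_lin _ _ 1 (- (z * q ^ n)) _ _ IH (is_zseries_pred _ _ IH)).
  replace (l * qpoch q z (S n))
    with (1 * (l * qpoch q z n) + - (z * q ^ n) * (l * qpoch q z n)) by (simpl; ring).
  apply is_zseries_ext; intros j; rewrite psi_trunc_succ by auto; ring.
Qed.

(** Tannery's theorem for [psi_trunc] as n tends to infinity: the truncated products are at least 1,
    so [psi_term] dominates, and the denominators tend to theta. *)
Lemma psi_theta (q x z l : R) : 0 < q < 1 -> 0 < x -> 0 < z < 1 ->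
  is_zseries (psi_term q x z) l ->
  is_zseries (fun j => powerRZ z j / theta q (x * powerRZ q j)) (l * qpoch_inf q z).
Proof.
intros Hq Hx Hz Hl.
assert (Hy : forall j, 0 < x * powerRZ q j)
  by (intros; apply Rmult_lt_0_compat; auto; apply powerRZ_lt; lra).
assert (Hqy : forall j, 0 < q / (x * powerRZ q j))
  by (intros; apply Rdiv_lt_0_compat; auto; lra).
apply tannery_zseries with (F := psi_trunc q x z) (G := psi_term q x z) (lG := l)
  (s := fun n => l * qpoch q z n); auto.
- intros n j; unfold psi_trunc, psi_term; specialize (Hy j); specialize (Hqy j).
  assert (P1 := pinf_ge q _ Hq (Rlt_le _ _ Hy)).
  assert (P2 := qpoch_neg_ge1 q (- (q / (x * powerRZ q j))) n Hq ltac:(lra)).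
  assert (Pz : 0 < powerRZ z j) by (apply powerRZ_lt; lra).
  rewrite Rabs_pos_eq.
  + apply Rmult_le_compat_l; [lra|apply Rinv_le_contravar; nra].
  + left; apply Rdiv_lt_0_compat; nra.
- intros j; specialize (Hy j); specialize (Hqy j); unfold psi_trunc.
  apply is_lim_seq_div'; [apply is_lim_seq_const| |apply Rgt_not_eq, theta_pos; auto].
  apply (is_lim_seq_scal_l _ _ (pinf q (q / (x * powerRZ q j)))).
  apply qpoch_inf_lim; auto; lra.
- intros n; apply psi_trunc_sum; auto; lra.
- apply (is_lim_seq_scal_l _ _ (qpoch_inf q z)); apply qpoch_inf_lim; lra.
Qed.

(** Both sides are 1 at j = 0, and going from j to j + 1 multiplies them by x z q^j, which depends
    on x and z only through their product. *)
Lemma theta_term_eq (q x z x' z' : R) (j : Z) :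
  0 < q < 1 -> 0 < x -> 0 < z -> 0 < x' -> 0 < z' -> x * z = x' * z' ->
  theta q x * (powerRZ z j / theta q (x * powerRZ q j)) =
  theta q x' * (powerRZ z' j / theta q (x' * powerRZ q j)).
Proof.
intros Hq Hx Hz Hx' Hz' E.
assert (Hpow : forall i, 0 < powerRZ q i) by (intros; apply powerRZ_lt; lra).
assert (Hstep : forall y w i, 0 < y -> 0 < w ->
  theta q y * (powerRZ w (Z.succ i) / theta q (y * powerRZ q (Z.succ i))) =
  y * w * powerRZ q i * (theta q y * (powerRZ w i / theta q (y * powerRZ q i)))).
{ intros y w i Hy Hw; specialize (Hpow i).
  assert (Hyi : 0 < y * powerRZ q i) by nra.
  assert (P := theta_pos q _ Hq Hyi).
  unfold Z.succ; rewrite !powerRZ_succ, <- Rmult_assoc, theta_shift by lra.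
  field; repeat split; lra. }
pattern j; apply Z.bi_induction.
- intros ? ? ->; reflexivity.
- simpl; rewrite !Rmult_1_r.
  assert (P := theta_pos q x Hq Hx); assert (P' := theta_pos q x' Hq Hx').
  field; lra.
(* [Z.bi_induction] asks for an equivalence; backwards, the positive factor is cancelled. *)
- intros i; rewrite !Hstep, <- E by auto; split; [now intros ->|].
  intros H; apply Rmult_eq_reg_l in H; [exact H|]; apply Rgt_not_eq.
  apply Rmult_lt_0_compat; auto; now apply Rmult_lt_0_compat.
Qed.

(* Ramanujan's 1psi1 summation with the lower parameter equal to 0. *)
Lemma psi_sum (q x z : R) : 0 < q < 1 -> 0 < x -> 0 < z < 1 ->
  is_zseries (psi_term q x z)
    (qpoch_inf q q * theta q (x * z) / (qpoch_inf q z * theta q x)).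
Proof.
intros Hq Hx Hz; destruct (psi_ex q x z Hq Hx Hz) as [l Hl].
enough (E : l = qpoch_inf q q * theta q (x * z) / (qpoch_inf q z * theta q x))
  by now rewrite <- E.
(* The point x' = xz / q pairs with z' = q: then x' z' = x z, and the sum at z' is known from
   [psi_q] to be 1 / x'. *)
assert (Hx' : 0 < x * z / q) by (apply Rdiv_lt_0_compat; nra).
assert (A := is_zseries_scal _ (theta q x) _ (psi_theta q x z l Hq Hx Hz Hl)).
assert (B := is_zseries_scal _ (theta q (x * z / q)) _
  (psi_theta q (x * z / q) q _ Hq Hx' Hq (psi_q q (x * z / q) Hq Hx'))).
apply (is_zseries_ext _ (fun j => theta q x * (powerRZ z j / theta q (x * powerRZ q j)))) in B.
- assert (E := is_zseries_unique _ _ _ A B).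
  assert (Et := theta_shift q _ Hq Hx').
  replace (x * z / q * q) with (x * z) in Et by (field; lra).
  assert (P1 := theta_pos q x Hq Hx); assert (P2 := qpoch_inf_pos q z Hq ltac:(lra)).
  apply Rmult_eq_reg_l with (theta q x * qpoch_inf q z);
    [|apply Rgt_not_eq; now apply Rmult_lt_0_compat].
  replace (theta q x * qpoch_inf q z * l) with (theta q x * (l * qpoch_inf q z)) by ring.
  rewrite E, Et; field; lra.
- intros j; apply theta_term_eq; auto; try lra; field; lra.
Qed.

Lemma triangular_succ (n : nat) : (S n * (S n - 1) / 2 = n * (n - 1) / 2 + n)%nat.
Proof.
rewrite <- Nat.div_add by lia; f_equal; destruct n; simpl; lia.
Qed.

(** Iterates [psi_step]: the factors (1 - z q^i) / (z q^i x) for i < n multiply up, and the powers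
    q^i give q^(n choose 2). *)
Lemma psi_sum_pow (q x z l : R) (n : nat) : 0 < q < 1 -> 0 < x -> 0 < z ->
  is_zseries (psi_term q x z) l ->
  is_zseries (psi_term q x (z * q ^ n))
    (l * qpoch q z n / (z ^ n * x ^ n * q ^ (n * (n - 1) / 2)%nat)).
Proof.
intros Hq Hx Hz Hl; induction n as [|n IH].
- simpl; rewrite !Rmult_1_r; now replace (l / 1) with l by field.
- assert (Hqn := pow_le_1 q n Hq).
  generalize (psi_step q x (z * q ^ n) _ Hq Hx ltac:(nra) IH).
  rewrite triangular_succ, pow_add.
  replace (z * q ^ n * q) with (z * q ^ S n) by (simpl; ring).
  set (T := q ^ (n * (n - 1) / 2)%nat).
  assert (HT : 0 < T) by (apply pow_lt; lra).
  assert (0 < z ^ n) by now apply pow_lt.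
  assert (0 < x ^ n) by now apply pow_lt.
  replace (l * qpoch q z (S n) / _) with
    (l * qpoch q z n / (z ^ n * x ^ n * T) * (1 - z * q ^ n) / (z * q ^ n * x)); auto.
  simpl; field; repeat split; lra.
Qed.

(** * Absolute convergence of basic hypergeometric series *)

Lemma Cqpochs_le (q : R) (l : list C) : 0 < q < 1 ->
  exists M, 0 <= M /\ forall n, Cmod (Cqpochs q l n) <= M.
Proof.
intros Hq; induction l as [|a l [M [HM IH]]].
- exists 1; split; [lra|]; intros n; simpl; rewrite Cmod_1; lra.
- exists (exp (Cmod a / (1 - q)) * M); split.
  + apply Rmult_le_pos; auto; left; apply exp_pos.
  + intros n; simpl; rewrite Cmod_mult.
    apply Rmult_le_compat; auto using Cmod_ge_0; now apply Cqpoch_le.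
Qed.

Lemma Cqpochs_ge (q : R) (l : list C) : 0 < q < 1 ->
  (forall a n, In a l -> Cqpoch q a n <> RtoC 0) ->
  exists c, 0 < c /\ forall n, c <= Cmod (Cqpochs q l n).
Proof.
intros Hq; induction l as [|a l IH]; intros Hl.
- exists 1; split; [lra|]; intros n; simpl; rewrite Cmod_1; lra.
- destruct IH as (c & Hc & H); [intros; apply Hl; now right|].
  destruct (Cqpoch_ge q a Hq) as (c' & Hc' & H'); [intros; apply Hl; now left|].
  exists (c' * c); split; [now apply Rmult_lt_0_compat|].
  intros n; simpl; rewrite Cmod_mult; apply Rmult_le_compat; auto; lra.
Qed.

Lemma Cqpochs_eventually_0 (q : R) (l : list C) (a : C) (N n : nat) :
  In a l -> Cqpoch q a N = RtoC 0 -> (N <= n)%nat -> Cqpochs q l n = RtoC 0.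
Proof.
intros Ha HN Hn.
assert (H0 : Cqpoch q a n = RtoC 0).
{ induction Hn as [|n Hn IH]; auto; simpl; rewrite IH; ring. }
induction l as [|b l IH]; [easy|].
destruct Ha as [->|Ha]; simpl.
- rewrite H0; ring.
- rewrite (IH Ha); ring.
Qed.

Lemma Cqpochs_app (q : R) (l l' : list C) (n : nat) :
  Cqpochs q (l ++ l') n = (Cqpochs q l n * Cqpochs q l' n)%C.
Proof.
induction l as [|a l IH]; simpl.
- now rewrite Cmult_1_l.
- rewrite IH; ring.
Qed.

Lemma powerRZ_pow (q : R) (n : nat) (w : Z) : powerRZ (q ^ n) w = powerRZ q w ^ n.
Proof.
induction n as [|n IH]; simpl; [apply powerRZ_R1|].
now rewrite powerRZ_mult, IH.
Qed.

Lemma Rabs_powerRZ (x : R) (w : Z) : Rabs (powerRZ x w) = powerRZ (Rabs x) w.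
Proof.
destruct w as [|p|p]; simpl.
- apply Rabs_R1.
- symmetry; apply RPow_abs.
- rewrite Rabs_inv; f_equal; symmetry; apply RPow_abs.
Qed.

Lemma not_lim_0_above (s : nat -> R) (N : nat) (c : R) :
  0 < c -> (forall n, c <= s (N + n)%nat) -> ~ is_lim_seq s 0.
Proof.
intros Hc Hs Hl; apply (is_lim_seq_incr_n _ N) in Hl.
assert (H : Rbar_le c 0); [|simpl in H; lra].
apply (is_lim_seq_le (fun _ => c) (fun n => s (n + N)%nat) c 0); auto.
- intros n; rewrite Nat.add_comm; apply Hs.
- apply is_lim_seq_const.
Qed.

(** Consecutive terms have ratio p^n r. For p <= 1 it does not increase, so once below 1 it forces
    geometric decay; for p > 1 it grows without bound, which contradicts the limit 0. *)
Lemma ex_series_triangular_pow (p r : R) : 0 < p -> 0 < r ->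
  is_lim_seq (fun n => p ^ (n * (n - 1) / 2)%nat * r ^ n) 0 ->
  ex_series (fun n => p ^ (n * (n - 1) / 2)%nat * r ^ n).
Proof.
intros Hp Hr; set (s := fun n => _); intros Hl.
assert (Hs : forall n, s (S n) = s n * (p ^ n * r)).
{ intros n; unfold s; rewrite triangular_succ, pow_add; simpl; ring. }
assert (Hpos : forall n, 0 < s n) by (intros; apply Rmult_lt_0_compat; now apply pow_lt).
assert (Hgrow : forall N, ~ (forall n, 1 <= p ^ (N + n) * r)).
{ intros N H; apply (not_lim_0_above s N (s N)); auto.
  induction n as [|n IH]; [rewrite Nat.add_0_r; lra|].
  rewrite Nat.add_succ_r, Hs; specialize (H n); specialize (Hpos (N + n)%nat); nra. }
destruct (Rle_dec p 1) as [Hp1|Hp1].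
- destruct (not_all_ex_not _ _ (Hgrow 0%nat)) as [N HN]; simpl in HN.
  apply (ex_series_incr_n (V := R_NormedModule) s N).
  apply ex_series_le_R with (fun k => s N * (p ^ N * r) ^ k).
  + intros k; rewrite Rabs_pos_eq by (left; auto).
    induction k as [|k IH]; [rewrite Nat.add_0_r; simpl; lra|].
    rewrite Nat.add_succ_r, Hs; simpl.
    assert (p ^ (N + k) <= p ^ N).
    { rewrite pow_add; rewrite <- (Rmult_1_r (p ^ N)) at 2.
      apply Rmult_le_compat_l; [left; now apply pow_lt|].
      rewrite <- (pow1 k); apply pow_incr; lra. }
    assert (0 < p ^ (N + k)) by now apply pow_lt.
    replace (s N * (p ^ N * r * (p ^ N * r) ^ k))
      with (s N * (p ^ N * r) ^ k * (p ^ N * r)) by ring.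
    apply Rmult_le_compat; auto; [left; auto|nra|nra].
  + apply (ex_series_scal (V := R_NormedModule) (s N) (fun k => (p ^ N * r) ^ k)).
    apply ex_series_geom; assert (0 < p ^ N) by now apply pow_lt.
    rewrite Rabs_pos_eq; nra.
- exfalso.
  destruct (Pow_x_infinity p) with (b := / r) as [N HN];
    [rewrite Rabs_pos_eq; lra|].
  apply (Hgrow N); intros n.
  specialize (HN (N + n)%nat ltac:(lia)).
  rewrite Rabs_pos_eq in HN by (left; now apply pow_lt).
  apply Rmult_le_reg_r with (/ r); [now apply Rinv_0_lt_compat|].
  rewrite Rmult_assoc, Rinv_r, Rmult_1_r, Rmult_1_l by lra; lra.
Qed.

Lemma ex_series_eventually_0 (a : nat -> R) (N : nat) :
  (forall n, (N <= n)%nat -> a n = 0) -> ex_series a.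
Proof.
intros H; apply (ex_series_incr_n (V := R_NormedModule) a N).
apply ex_series_le_R with (fun n => (/ 2) ^ n).
- intros n; rewrite H, Rabs_R0 by lia; apply pow_le; lra.
- apply ex_series_geom; rewrite Rabs_pos_eq; lra.
Qed.

(* If no parameter makes the series terminate, the modulus of its general term
   lies between positive multiples of [p ^ (n choose 2) * r ^ n]. *)
Lemma ex_qhyp_abs (q : R) (la lb : list C) (z : C) : 0 < q < 1 ->
  (forall (b : C) (n : nat), In b lb -> Cqpoch q b n <> RtoC 0) ->
  ex_qhyp q la lb z -> ex_series (fun n => Cmod (qhyp_term q la lb z n)).
Proof.
intros Hq Hlb Hex.
destruct (classic (exists a N, In a la /\ Cqpoch q a N = RtoC 0)) as [(a & N & Ha & HN)|Hla].
{ apply ex_series_eventually_0 with N; intros n Hn; unfold qhyp_term.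
  rewrite (Cqpochs_eventually_0 q la a N n) by auto.
  unfold Cdiv; rewrite !Cmult_0_l; apply Cmod_0. }
destruct (classic (z = RtoC 0)) as [->|Hz].
{ apply ex_series_eventually_0 with 1%nat; intros [|n] Hn; [lia|].
  unfold qhyp_term; rewrite Cpow_S; unfold Cdiv.
  rewrite !Cmult_0_l, Cmult_0_r; apply Cmod_0. }
destruct (Cqpochs_le q la Hq) as (Ma & HMa & HMa').
destruct (Cqpochs_ge q la Hq) as (ca & Hca & Hca').
{ intros a n Ha E; apply Hla; now exists a, n. }
(* The denominator (q; q)_n is treated as one more lower parameter. *)
set (lb' := RtoC q :: lb).
assert (Hlb' : forall b n, In b lb' -> Cqpoch q b n <> RtoC 0).
{ intros b n [<-|Hb]; [|now apply Hlb].
  rewrite Cqpoch_RtoC; intros E; apply RtoC_inj in E.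
  generalize (qpoch_pos q q n Hq ltac:(lra)); lra. }
destruct (Cqpochs_le q lb' Hq) as (Mb & HMb & HMb').
destruct (Cqpochs_ge q lb' Hq Hlb') as (cb & Hcb & Hcb').
set (w := (1 + Z.of_nat (length lb) - Z.of_nat (length la))%Z).
set (p := powerRZ q w); set (r := Cmod z).
assert (Hp : 0 < p) by (apply powerRZ_lt; lra).
assert (Hr : 0 < r) by now apply Cmod_gt_0.
set (s := fun n => p ^ (n * (n - 1) / 2)%nat * r ^ n).
assert (Hs : forall n, 0 < s n) by (intros; apply Rmult_lt_0_compat; now apply pow_lt).
assert (Ht : forall n, Cmod (qhyp_term q la lb z n) =
   Cmod (Cqpochs q la n) / Cmod (Cqpochs q lb' n) * s n).
{ intros n; unfold qhyp_term, lb', s, p, r; fold w.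
  assert (P := qpoch_pos q q n Hq ltac:(lra)).
  specialize (Hcb' n); simpl in Hcb' |- *.
  rewrite Cqpoch_RtoC, Cmod_mult, Cmod_R, (Rabs_pos_eq (qpoch q q n)) in * by lra.
  assert (Hb : 0 < Cmod (Cqpochs q lb n)) by (generalize (Cmod_ge_0 (Cqpochs q lb n)); nra).
  rewrite !Cmod_mult, !Cmod_div, Cmod_pow, !Cmod_R, (Rabs_pos_eq (qpoch q q n)), Rabs_powerRZ
    by (try (now apply Cmod_gt_0); try lra; intros E; apply RtoC_inj in E; lra).
  rewrite Rabs_mult, pow_1_abs, Rmult_1_l.
  rewrite Rabs_pos_eq, powerRZ_pow by (left; now apply pow_le_1).
  field; lra. }
apply ex_series_C_lim_0 in Hex.
(* Terms of a convergent series tend to 0, and [s n] is at most Mb / ca times their modulus; so [s]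
   tends to 0, which already makes it summable. *)
assert (Hsum : ex_series s).
{ apply ex_series_triangular_pow; auto; fold s.
  apply is_lim_seq_le_le with (fun _ => 0)
    (fun n => Mb / ca * Cmod (qhyp_term q la lb z n)); [|apply is_lim_seq_const|].
  - intros n; split; [left; auto|]; rewrite Ht.
    specialize (Hs n); specialize (HMb' n); specialize (Hcb' n); specialize (Hca' n).
    set (A := Cmod (Cqpochs q la n)) in *; set (B := Cmod (Cqpochs q lb' n)) in *.
    replace (Mb / ca * (A / B * s n)) with (Mb / B * (A / ca) * s n) by (field; lra).
    rewrite <- (Rmult_1_l (s n)) at 1; apply Rmult_le_compat_r; [lra|].
    rewrite <- (Rmult_1_l 1); apply Rmult_le_compat; try lra.
    + apply Rmult_le_reg_r with B; [lra|]; field_simplify; lra.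
    + apply Rmult_le_reg_r with ca; [lra|]; field_simplify; lra.
  - replace (Finite 0) with (Rbar_mult (Mb / ca) (Finite 0)) by (simpl; f_equal; ring).
    now apply is_lim_seq_scal_l. }
apply ex_series_le_R with (fun n => Ma / cb * s n);
  [|now apply (ex_series_scal (V := R_NormedModule) (Ma / cb) s)].
intros n; rewrite Rabs_pos_eq, Ht by apply Cmod_ge_0.
apply Rmult_le_compat_r; [left; auto|].
specialize (Hcb' n); apply Rmult_le_compat; auto using Cmod_ge_0.
- left; apply Rinv_0_lt_compat; lra.
- apply Rinv_le_contravar; lra.
Qed.

(** * From the kernel sums to the transform *)

Lemma is_bilateral_series_C (F : Z -> C) (l : C) :
  is_zseries (fun j => Re (F j)) (Re l) -> is_zseries (fun j => Im (F j)) (Im l) ->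
  is_bilateral_series F l.
Proof.
intros (rp & rn & Hrp & Hrn & Er) (ip & im & Hip & Him & Ei).
exists (rp, ip), (rn, im); repeat split.
- now apply is_series_C.
- now apply is_series_C.
- destruct l as [lr li]; simpl in Er, Ei; unfold Cplus; simpl; congruence.
Qed.

(** For b = alpha, the weight q^j of the q-integral and the power x^(alpha-1) at x = q^j combine
    into z^j with z = q^alpha. *)
Lemma Rpower_powerRZ (q b : R) (j : Z) : 0 < q ->
  powerRZ q j * Rpower (powerRZ q j) (b - 1) = powerRZ (Rpower q b) j.
Proof.
intros Hq; assert (H := powerRZ_lt q j Hq).
rewrite <- (Rpower_1 (powerRZ q j)) at 1 by auto.
rewrite <- Rpower_plus; replace (1 + (b - 1)) with b by ring.
rewrite !powerRZ_Rpower by (auto; apply exp_pos).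
rewrite !Rpower_mult; f_equal; ring.
Qed.

Lemma qhyp_term_scal (q : R) (la lb : list C) (a y : R) (n : nat) :
  qhyp_term q la lb (RtoC (a * y)) n
  = (qhyp_term q la lb (RtoC a) n * RtoC (y ^ n))%C.
Proof.
unfold qhyp_term, Cdiv; rewrite <- !RtoC_pow, Rpow_mult_distr, RtoC_mult; ring.
Qed.

(** A further upper parameter lowers the exponent of (-1)^n q^(n choose 2) by one. The kernel sum
    supplies the division by q^(n choose 2); the leftover (-1)^n goes into the argument, whence its
    minus sign. *)
Lemma qhyp_term_app (q a x z : R) (la lb : list C) (n : nat) :
  0 < q < 1 -> x <> 0 -> z <> 0 ->
  (qhyp_term q la lb (RtoC a) n
     * RtoC (qpoch q z n / (z ^ n * x ^ n * q ^ (n * (n - 1) / 2)%nat)))%C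
  = qhyp_term q (la ++ RtoC z :: nil) lb (RtoC (- (a / (x * z)))) n.
Proof.
intros Hq Hx Hz; unfold qhyp_term; rewrite Cqpochs_app, length_app.
simpl Cqpochs; simpl length; rewrite Cqpoch_RtoC, Cmult_1_r.
assert (P := qpoch_pos q q n Hq ltac:(lra)).
set (B := (-1) ^ n * q ^ (n * (n - 1) / 2)%nat).
assert (HT : 0 < q ^ (n * (n - 1) / 2)%nat) by (apply pow_lt; lra).
assert (H1 : (-1) ^ n <> 0) by (apply pow_nonzero; lra).
assert (HB : B <> 0) by (apply Rmult_integral_contrapositive; split; lra).
replace (1 + Z.of_nat (length lb) - Z.of_nat (length la + 1))%Z
  with (1 + Z.of_nat (length lb) - Z.of_nat (length la) + - (1))%Z by lia.
rewrite powerRZ_add, powerRZ_neg', powerRZ_1 by auto.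
set (e := powerRZ B _).
rewrite <- !RtoC_pow, <- !RtoC_div by lra.
(* The complex quotient is kept as a common factor, so that an identity between reals remains. *)
transitivity (Cqpochs q la n / Cqpochs q lb n * RtoC (e * (a ^ n / qpoch q q n) *
  (qpoch q z n / (z ^ n * x ^ n * q ^ (n * (n - 1) / 2)%nat))))%C.
{ rewrite !RtoC_mult; ring. }
transitivity (Cqpochs q la n / Cqpochs q lb n * RtoC (qpoch q z n *
  (e * / B) * ((- (a / (x * z))) ^ n / qpoch q q n)))%C.
- do 2 f_equal.
  replace (- (a / (x * z))) with (-1 * a * / x * / z) by (field; lra).
  rewrite !Rpow_mult_distr, !pow_inv; unfold B.
  assert (x ^ n <> 0) by now apply pow_nonzero.
  assert (z ^ n <> 0) by now apply pow_nonzero.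
  field; repeat split; lra.
- unfold Cdiv; rewrite !RtoC_mult; ring.
Qed.

Lemma Rpower_lt_1 (q b : R) : 0 < q < 1 -> 0 < b -> Rpower q b < 1.
Proof.
intros Hq Hb; unfold Rpower; rewrite <- exp_0; apply exp_increasing.
assert (ln q < 0) by (rewrite <- ln_1; apply ln_increasing; lra); nra.
Qed.

(** Identifies the constant of the theorem with the value of S(z) at x = 1/A, z = q^b. The powers of
    1 - q cancel, and (-q/A; q)_oo (-A; q)_oo = A theta(1/A) absorbs the quotient A of the two
    powers of A. *)
Lemma psi_const (q A b : R) : 0 < q < 1 -> 0 < A -> 0 < b ->
  Rpower A b * Rpower (1 - q) (b - 1) * Gamma_q q b / K_q q A b
  = qpoch_inf q q * theta q (/ A * Rpower q b)
    / (qpoch_inf q (Rpower q b) * theta q (/ A)).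
Proof.
intros Hq HA Hb; unfold Gamma_q, K_q, theta.
set (z := Rpower q b).
assert (Hz : 0 < z) by apply exp_pos.
assert (Hz1 : z < 1) by now apply Rpower_lt_1.
assert (HiA : 0 < / A) by now apply Rinv_0_lt_compat.
replace (Rpower q (1 - b)) with (q / z).
2:{ unfold Rminus; rewrite Rpower_plus, Rpower_Ropp, Rpower_1 by lra; reflexivity. }
replace (Rpower (1 - q) (1 - b)) with (/ Rpower (1 - q) (b - 1)).
2:{ rewrite <- Rpower_Ropp; f_equal; ring. }
replace (Rpower A b) with (A * Rpower A (b - 1)).
2:{ rewrite <- (Rpower_1 A) at 1 by auto; rewrite <- Rpower_plus; f_equal; ring. }
replace (q / / A) with (A * q) by (field; lra).
replace (q / (/ A * z)) with (A * (q / z)) by (field; lra).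
replace (qpoch_inf q (- q / A)) with (pinf q (/ A * q))
  by (unfold pinf; f_equal; field; lra).
replace (qpoch_inf q (- z / A)) with (pinf q (/ A * z))
  by (unfold pinf; f_equal; field; lra).
replace (qpoch_inf q (- A * (q / z))) with (pinf q (A * (q / z)))
  by (unfold pinf; f_equal; field; lra).
change (qpoch_inf q (- A)) with (pinf q A).
rewrite (pinf_shift q A), (pinf_shift q (/ A)) by lra.
assert (0 < Rpower A (b - 1)) by apply exp_pos.
assert (0 < Rpower (1 - q) (b - 1)) by apply exp_pos.
assert (0 < qpoch_inf q z) by now apply qpoch_inf_pos.
assert (Hpos : forall y, 0 < y -> 0 < pinf q y)
  by (intros y Hy; generalize (pinf_ge q y Hq); lra).
assert (0 < pinf q (/ A * q)) by (apply Hpos; nra).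
assert (0 < pinf q (A * q)) by (apply Hpos; nra).
assert (0 < pinf q (/ A * z)) by (apply Hpos; nra).
assert (0 < pinf q (A * (q / z)))
  by (apply Hpos, Rmult_lt_0_compat; auto; apply Rdiv_lt_0_compat; lra).
field; repeat split; lra.
Qed.

(** In contrast to the opening formula, the argument on the right carries a minus sign, which comes
    from [qhyp_term_app]. Convergence of the right-hand series supplies the absolute convergence
    behind the exchange of sums. *)
Theorem theorem11 :
  forall (q alpha a u v : R) (m : nat) (k : Z) (la lb : list C),
    0 < q < 1 ->
    0 < alpha ->
    0 < u / v ->
    (1 <= m)%nat ->
    Z.of_nat (length la) = (Z.of_nat m - k)%Z ->
    Z.of_nat (length lb) = (Z.of_nat m - 1)%Z ->
    (forall (b : C) (n : nat), In b lb -> Cqpoch q b n <> RtoC 0) ->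
    (forall x : R, 0 < x -> ex_qhyp q la lb (RtoC (a * x))) ->
    ex_qhyp q (la ++ RtoC (Rpower q alpha) :: nil) lb
      (RtoC (- (a * u / (v * Rpower q alpha)))) ->
    is_qNatural q
      (fun x : R =>
         (RtoC (Rpower x (alpha - 1)) * qhyp q la lb (RtoC (a * x)))%C)
      u v
      (RtoC (Rpower (u / v) alpha * Rpower (1 - q) (alpha - 1)
             * Gamma_q q alpha / K_q q (u / v) alpha)
       * qhyp q (la ++ RtoC (Rpower q alpha) :: nil) lb
           (RtoC (- (a * u / (v * Rpower q alpha)))))%C.
Proof.
intros q alpha a u v m k la lb Hq Halpha Huv _ _ _ Hlb _ Hex.
assert (Hu : u <> 0) by (intros ->; unfold Rdiv in Huv; rewrite Rmult_0_l in Huv; lra).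
(* Since [/ 0] is 0 by [Rinv_0], v = 0 would make u / v zero. *)
assert (Hv : v <> 0).
{ intros ->; unfold Rdiv in Huv; rewrite Rinv_0, Rmult_0_r in Huv; lra. }
rewrite (psi_const q (u / v) alpha Hq Huv Halpha).
set (x := / (u / v)); set (z := Rpower q alpha) in *.
assert (Hx : 0 < x) by now apply Rinv_0_lt_compat.
assert (Hz : 0 < z < 1) by (split; [apply exp_pos|now apply Rpower_lt_1]).
replace (- (a * u / (v * z))) with (- (a / (x * z))) in *
  by (unfold x; field; repeat split; lra).
assert (HS := psi_sum q x z Hq Hx Hz).
set (S0 := qpoch_inf q q * theta q (x * z) / (qpoch_inf q z * theta q x)) in *.
assert (HS0 : 0 < S0).
{ assert (P1 := theta_pos q x Hq Hx).
  assert (P2 := theta_pos q (x * z) Hq ltac:(nra)).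
  assert (P3 := qpoch_inf_pos q q Hq ltac:(lra)).
  assert (P4 := qpoch_inf_pos q z Hq ltac:(lra)).
  apply Rdiv_lt_0_compat; now apply Rmult_lt_0_compat. }
set (t := qhyp_term q (la ++ RtoC z :: nil) lb (RtoC (- (a / (x * z))))).
set (c := qhyp_term q la lb (RtoC a)).
(* The ratio of S(z q^n) to S(z). *)
set (g := fun n => qpoch q z n / (z ^ n * x ^ n * q ^ (n * (n - 1) / 2)%nat)).
assert (Hct : forall n, (c n * RtoC (g n))%C = t n)
  by (intros n; apply qhyp_term_app; auto; lra).
assert (Hg : forall n, 0 < g n).
{ intros n; apply Rdiv_lt_0_compat; [apply qpoch_pos; lra|].
  repeat apply Rmult_lt_0_compat; apply pow_lt; lra. }
assert (Hker : forall n, is_zseries (psi_term q x (z * q ^ n)) (S0 * g n)).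
{ intros n; replace (S0 * g n) with
    (S0 * qpoch q z n / (z ^ n * x ^ n * q ^ (n * (n - 1) / 2)%nat))
    by (unfold g, Rdiv; ring).
  apply psi_sum_pow; auto; lra. }
assert (Habs := ex_qhyp_abs _ _ _ _ Hq Hlb Hex); fold t in Habs.
(* One argument serves [Re] and [Im]: only compatibility with real factors and the bound by the
   modulus are used. *)
assert (Hpart : forall part : C -> R,
  (forall w (r : R), part (w * RtoC r)%C = part w * r) ->
  (forall w, Rabs (part w) <= Cmod w) ->
  is_zseries (fun j => psi_term q x z j *
      Series (fun n => part (qhyp_term q la lb (RtoC (a * powerRZ q j)) n)))
    (S0 * Series (fun n => part (t n)))).
{ intros part Hlin Hle.
  assert (H : is_zseries
    (fun j => Series (fun n => part (c n) * psi_term q x (z * q ^ n) j))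
    (Series (fun n => part (c n) * (S0 * g n)))).
  { apply (zseries_exchange (fun n => part (c n)) (fun n => S0 * g n)
             (fun j n => psi_term q x (z * q ^ n) j)); auto.
    - intros j n; left; apply psi_term_pos; auto.
      apply Rmult_lt_0_compat; [lra|now apply pow_le_1].
    (* Multiplied by its kernel sum, the n-th coefficient becomes S0 times the n-th term of the
       target series, whose moduli are summable. *)
    - apply ex_series_le_R with (fun n => S0 * Cmod (t n));
        [|now apply (ex_series_scal (V := R_NormedModule) S0)].
      intros n; specialize (Hg n).
      rewrite Rabs_pos_eq by (apply Rmult_le_pos; [apply Rabs_pos|nra]).
      replace (Rabs (part (c n)) * (S0 * g n)) with (S0 * Rabs (part (t n))).
      + apply Rmult_le_compat_l; [lra|apply Hle].
      + rewrite <- Hct, Hlin, Rabs_mult, (Rabs_pos_eq (g n)) by lra; ring. }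
  replace (S0 * Series _) with (Series (fun n => part (c n) * (S0 * g n))).
  - revert H; apply is_zseries_ext; intros j.
    rewrite <- Series_scal_l; apply Series_ext; intros n.
    rewrite qhyp_term_scal, Hlin; fold c.
    unfold psi_term; rewrite powerRZ_mult, powerRZ_pow; unfold Rdiv; ring.
  - rewrite <- Series_scal_l; apply Series_ext; intros n.
    rewrite <- Hct, Hlin; ring. }
(* The weight and the power of the variable give z^j, and [e_q] gives 1 / [pinf] (x q^j). *)
assert (Hterm : forall j, (RtoC (powerRZ q j) *
   (RtoC (Rpower (powerRZ q j) (alpha - 1)) * qhyp q la lb (RtoC (a * powerRZ q j)) *
    RtoC (e_q q (- (v / u) * powerRZ q j))) =
   RtoC (psi_term q x z j) * qhyp q la lb (RtoC (a * powerRZ q j)))%C).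
{ intros j; unfold psi_term, pinf, e_q, z.
  rewrite <- Rpower_powerRZ by lra.
  replace (- (x * powerRZ q j)) with (- (v / u) * powerRZ q j)
    by (unfold x; field; lra).
  unfold Rdiv; rewrite !RtoC_mult; ring. }
set (N := (RtoC S0 * qhyp q _ lb _)%C).
(* The factor 1 - q of the q-integral cancels against the prefactor of the transform. *)
exists (RtoC (1 - q) * N)%C; split.
- exists N; split; auto.
  apply is_bilateral_series_C.
  + generalize (Hpart Re (fun w r => re_scal_r w r) re_le_Cmod).
    unfold N; rewrite re_scal_l; apply is_zseries_ext; intros j.
    now rewrite Hterm, re_scal_l.
  + generalize (Hpart Im (fun w r => im_scal_r w r) Rabs_Im_le_Cmod).
    unfold N; rewrite im_scal_l; apply is_zseries_ext; intros j.
    now rewrite Hterm, im_scal_l.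
- rewrite Cmult_assoc, <- RtoC_mult, Rinv_l by lra; ring.
Qed.
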